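(* Let $\mathbf m=(m_1,\dots,m_n)$ be positive integers. The number of join-irreducible elements of the combinatorial barcode lattice $\mathbf{BL}(\mathbf m)$ is \[\prod_{i=1}^n(m_i+1)-(m_1+m_2+\dots+m_n+1)-\sum_{i=1}^{n-1}\left[\left(\prod_{j=1}^{i-1}m_j\right)\left(\prod_{j=i+1}^n(m_j+1)-1\right)\right].\]
   Context: $\mathbf{BL}(\mathbf m)$ is the set of words of the multiset with $m_i$ copies of $i$ ($i\in[n]$) in which, for each $i\in[n-1]$, the first occurrence of $i$ precedes the first occurrence of $i+1$, partially ordered by the reflexive-transitive closure of the relation: $s\lessdot t$ iff $t$ arises from $s$ by swapping two adjacent entries $a<b$ that appear as $ab$ in $s$. This poset is a lattice. An element is join-irreducible if it is not the minimum and is not the join of two elements strictly below it (equivalently, it covers exactly one element). *)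

(* Defs.v *)
From HB Require Import structures.
From mathcomp Require Import all_boot all_order all_algebra all_fingroup.
From mathcomp Require Import zify.

Set Implicit Arguments.
Unset Strict Implicit.
Unset Printing Implicit Defensive.

Import Order.TTheory.

(* The paper's letters and indices 1, ..., n are shifted to 0, ..., n-1.      *)

Definition is_barcode_word n (m : 'I_n -> nat) (w : seq 'I_n) : bool :=
  [forall i, count_mem i w == m i] &&
  [forall i : 'I_n, forall j : 'I_n,
     (val j == i.+1) ==> (index i w < index j w)].

Record barcode_word n (m : 'I_n -> nat) : Type := BarcodeWord {
  letters :> (\sum_i m i).-tuple 'I_n;
  _ : is_barcode_word m letters
}.

HB.instance Definition _ n (m : 'I_n -> nat) := [isSub for @letters n m].
HB.instance Definition _ n (m : 'I_n -> nat) :=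
  [Countable of barcode_word m by <:].
HB.instance Definition _ n (m : 'I_n -> nat) :=
  [Finite of barcode_word m by <:].

Definition swap_step n (m : 'I_n -> nat) : rel (barcode_word m) :=
  fun s t =>
    [exists k : 'I_(\sum_i m i), exists l : 'I_(\sum_i m i),
       [&& val l == k.+1,
           tnth s k < tnth s l
         & letters t == [tuple tnth s (tperm k l i) | i < \sum_i m i]]].

Definition barcode_le n (m : 'I_n -> nat) : rel (barcode_word m) :=
  connect (@swap_step n m).

(* A strictly decreasing statistic along swap steps; it only serves to prove  *)
(* that barcode_le is antisymmetric.                                          *)
Definition word_weight N n (s : N.-tuple 'I_n) : nat :=
  \sum_(k < N) k * tnth s k.

Lemma word_weight_swap N n (s : N.-tuple 'I_n) (k l : 'I_N) :
    val l = k.+1 -> tnth s k < tnth s l ->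
  word_weight [tuple tnth s (tperm k l i) | i < N] < word_weight s.
Proof.
move=> El lt_kl; have nkl : l != k by apply/eqP=> E; move: El; rewrite E /=; lia.
rewrite /word_weight (bigD1 k) //= (bigD1 l) //=.
rewrite [X in _ < X](bigD1 k) //= [X in _ < _ + X](bigD1 l) //=.
rewrite !tnth_mktuple tpermL tpermR !addnA.
rewrite [X in _ + X < _](eq_bigr (fun i : 'I_N => i * tnth s i)) => [|i /andP[ik il]].
  by rewrite ltn_add2r; move: El => /= ->; nia.
by rewrite tnth_mktuple tpermD // eq_sym.
Qed.

Lemma swap_step_weight n (m : 'I_n -> nat) (s t : barcode_word m) :
  swap_step s t -> word_weight t < word_weight s.
Proof.
case/existsP=> k /existsP[l /and3P[/eqP El lt_kl /eqP ->]].
exact: word_weight_swap.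
Qed.

Lemma barcode_le_weight n (m : 'I_n -> nat) (s t : barcode_word m) :
  barcode_le s t -> s = t \/ word_weight t < word_weight s.
Proof.
case/connectP=> p; elim: p s => [|u p IHp] s /=; first by move=> _ ->; left.
case/andP=> /swap_step_weight lt_us pth Et; right.
by case: (IHp u pth Et) => [<- //|lt_tu]; apply: ltn_trans lt_us.
Qed.

Lemma barcode_le_refl n (m : 'I_n -> nat) : reflexive (@barcode_le n m).
Proof. exact: connect0. Qed.

Lemma barcode_le_anti n (m : 'I_n -> nat) : antisymmetric (@barcode_le n m).
Proof.
move=> s t /andP[/barcode_le_weight[//|lt_ts] /barcode_le_weight[//|lt_st]].
by have := ltn_trans lt_ts lt_st; rewrite ltnn.
Qed.

Lemma barcode_le_trans n (m : 'I_n -> nat) : transitive (@barcode_le n m).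
Proof. exact: connect_trans. Qed.

Fact barcode_display : Order.disp_t. Proof. exact: Order.Disp tt tt. Qed.

HB.instance Definition _ n (m : 'I_n -> nat) :=
  Order.Le_isPOrder.Build barcode_display (barcode_word m)
    (@barcode_le_refl n m) (@barcode_le_anti n m) (@barcode_le_trans n m).

Definition is_minimum d (T : finPOrderType d) (x : T) : bool :=
  [forall y : T, (x <= y)%O].

(* Joins are least upper bounds, so no lattice instance is needed.            *)
Definition is_join d (T : finPOrderType d) (a b x : T) : bool :=
  [&& (a <= x)%O, (b <= x)%O
    & [forall u : T, ((a <= u)%O && (b <= u)%O) ==> (x <= u)%O]].

Definition join_irreducible d (T : finPOrderType d) (x : T) : bool :=
  ~~ is_minimum x &&
  ~~ [exists a : T, exists b : T, [&& (a < x)%O, (b < x)%O & is_join a b x]].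

(* Main.v *)
Require Import Defs.
From HB Require Import structures.
From mathcomp Require Import all_boot all_order all_algebra all_fingroup.
From mathcomp Require Import zify ring.

(* Number the copies of each letter by their order of appearance. The order   *)
(* on barcode words is containment of inversion sets, and undoing a descent   *)
(* of a barcode word removes exactly one inversion and gives a barcode word.  *)
(* Hence a word with two descents is the join of the two words obtained by    *)
(* undoing them, so the join-irreducible words are those with one descent:    *)
(* the unsorted words w with a cut w = AB into two sorted words.              *)
(* Each such w has a single cut, while the sorted word has m_1+...+m_n+1      *)
(* cuts. A cut is determined by the numbers c_i <= m_i of letters i in A, and *)
(* c comes from a barcode word iff {i | c_i > 0} is an initial segment; there *)
(* are m_1...m_r such c with support {1, ..., r}. The sum of these products   *)
(* is then brought to the required form by telescoping.                       *)

Import Order.TTheory GRing.Theory Num.Theory.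

Set Implicit Arguments.
Unset Strict Implicit.
Unset Printing Implicit Defensive.

(** [barcode_leP] identifies the order with containment of inversion sets: a swap adds at most one
    inversion, and [exists_descent_to_undo] brings a larger word down towards a smaller one.
    [join_irreducible_unsorted] then reduces the problem to unsorted words with a sorted cut.
    [card_join_irreducible] counts pairs of a word and a sorted cut twice: by word, through
    [card_sorted_cut], and by the letter counts of the left part, through [cut_vector_image] and
    [card_initial_vectors]. The second count is the sum over r <= n of the product of the first r
    entries of [m]; [sum_prod_lt_gt] brings it to closed form. *)

(** * Letter counts and inversions of words *)

Definition occ n (a : 'I_n) (w : seq 'I_n) : nat := count_mem a w.
Arguments occ : simpl never.

Lemma occ_nil n (a : 'I_n) : occ a [::] = 0.
Proof. by []. Qed.

Lemma occ_cons n (a x : 'I_n) w : occ a (x :: w) = (x == a) + occ a w.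
Proof. by []. Qed.

Lemma occ_cat n (a : 'I_n) v w : occ a (v ++ w) = occ a v + occ a w.
Proof. exact: count_cat. Qed.

Lemma occ_rcons n (a x : 'I_n) w : occ a (rcons w x) = occ a w + (x == a).
Proof. by rewrite -cats1 occ_cat occ_cons addn0. Qed.

Definition occE := (occ_cat, occ_rcons, occ_cons, occ_nil, addn0).

Lemma perm_occ n (v w : seq 'I_n) : (forall i, occ i v = occ i w) -> perm_eq v w.
Proof. by move=> E; apply/allP => i _; apply/eqP; apply: E. Qed.

Lemma occ_take_leq n (a : 'I_n) w i j :
  i <= j -> occ a (take i w) <= occ a (take j w).
Proof. by move=> le_ij; rewrite -(subnKC le_ij) takeD occ_cat leq_addr. Qed.

Lemma occ_take_le n (a : 'I_n) w j : occ a (take j w) <= occ a w.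
Proof. by rewrite -[in leqRHS](cat_take_drop j w) occ_cat leq_addr. Qed.

(* "The q-th b comes before the p-th a" (counting from 0), witnessed by a      *)
(* prefix that contains the former but not the latter.                        *)
Definition inverted n (w : seq 'I_n) (a : 'I_n) (p : nat) (b : 'I_n) (q : nat) :=
  exists j, occ a (take j w) <= p /\ q < occ b (take j w).

Definition inversion_le n (x u : seq 'I_n) :=
  forall (a b : 'I_n) p q, a < b -> inverted x a p b q -> inverted u a p b q.

(** The letters [x], [y] are quantified inside each case, so that one case split serves a word and
    its swap at once. *)
Lemma take_cat2 (T : Type) (P Q : seq T) j :
  [\/ forall x y, take j (P ++ x :: y :: Q) = take j P,
      forall x y, take j (P ++ x :: y :: Q) = rcons P x
    | exists i, forall x y,
        take j (P ++ x :: y :: Q) = P ++ x :: y :: take i Q].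
Proof.
case: (ltngtP j (size P)) => [lt_jP|lt_Pj|->].
- by constructor 1 => x y; rewrite take_cat lt_jP.
- case Ej: (j - size P) => [|[|i]]; first by lia.
    by constructor 2 => x y; rewrite take_cat ltnNge (ltnW lt_Pj) Ej /= ?take0 cats1.
  by constructor 3; exists i => x y; rewrite take_cat ltnNge (ltnW lt_Pj) Ej.
- by constructor 1 => x y; rewrite take_size_cat ?take_size.
Qed.

Lemma take_cat_size1 (T : Type) (P Q : seq T) x :
  take (size P).+1 (P ++ x :: Q) = rcons P x.
Proof. by rewrite -cat_rcons take_size_cat ?size_rcons. Qed.

Lemma take_cat_size2 (T : Type) (P Q : seq T) x y :
  take (size P).+2 (P ++ x :: y :: Q) = rcons (rcons P x) y.
Proof. by rewrite -!cat_rcons take_size_cat ?size_rcons. Qed.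

Lemma inversion_le_swap n (P Q : seq 'I_n) (a b : 'I_n) :
  a < b -> inversion_le (P ++ a :: b :: Q) (P ++ b :: a :: Q).
Proof.
move=> ltab a' b' p q lt' [j []].
case: (take_cat2 P Q j) => [E|E|[i E]].
- by rewrite E => ha hb; exists j; rewrite E.
(* The prefix ends between the swapped letters. If [b'] is [a], it is lengthened past both, which
   adds no [a'] since a' < a < b; otherwise it is shortened to [P]. *)
- rewrite E !occE => ha hb; case: (eqVneq a b') => [Eb|neb].
    subst b'; exists (size P).+2; rewrite take_cat_size2 !occE eqxx.
    have -> : (b == a') = false by apply/negP=> /eqP E'; rewrite E' in ltab; lia.
    have -> : (a == a') = false by apply/negP=> /eqP E'; rewrite E' in lt'; lia.
    by rewrite !addn0; lia.
  exists (size P); rewrite take_size_cat //; split; first by lia.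
  by move: hb; rewrite (negPf neb); lia.
- by rewrite E !occE => ha hb; exists j; rewrite E !occE; lia.
Qed.

Lemma inverted_swap n (P Q : seq 'I_n) (a b a' b' : 'I_n) p q :
    a < b -> a' < b' -> inverted (P ++ b :: a :: Q) a' p b' q ->
  inverted (P ++ a :: b :: Q) a' p b' q \/
  [/\ a' = a, p = occ a P, b' = b & q = occ b P].
Proof.
move=> ltab lt' [j []].
case: (take_cat2 P Q j) => [E|E|[i E]].
- by rewrite E => ha hb; left; exists j; rewrite E.
- rewrite E !occE => ha hb.
  (* A witness ending between the swapped letters is replaced by [P] ([viaP]) or by [P] with both
     letters ([viaQ]); if neither works, [p] and [q] are forced. *)
  have viaP : q < occ b' P -> inverted (P ++ a :: b :: Q) a' p b' q.
    by exists (size P); rewrite take_size_cat //; lia.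
  case: (eqVneq b b') hb => [Eb hb|_]; last by rewrite addn0; left; apply: viaP.
  subst b'; have nba : (b == a') = false by apply/eqP=> E'; move: lt'; rewrite E' ltnn.
  have viaQ : occ a' P + (a == a') <= p ->
      inverted (P ++ a :: b :: Q) a' p b q.
    exists (size P).+2; rewrite take_cat_size2 !occE nba eqxx; lia.
  rewrite nba addn0 in ha.
  case: (eqVneq a a') viaQ => [Ea|ne] viaQ; last by left; apply: viaQ; lia.
  subst a'; have [/viaP|ltq] := ltnP q (occ b P); first by left.
  have [le|ltp] := leqP (occ a P + 1) p; first by left; apply: viaQ.
  by right; split=> //; lia.
- by rewrite E !occE => ha hb; left; exists j; rewrite E !occE; lia.
Qed.

Lemma neq_split n (x u : seq 'I_n) : size x = size u -> x <> u ->
  exists P al be X U, [/\ x = P ++ be :: X, u = P ++ al :: U & al != be].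
Proof.
elim: x u => [|y x IH] [|z u] //= [size_xu] ne.
case: (eqVneq z y) => [Ezy|nzy]; last by exists [::], z, y, x, u.
subst z; have [|P [al [be [X [U [-> -> ?]]]]]] := IH u size_xu.
  by move=> E; rewrite E in ne.
by exists (y :: P), al, be, X, U.
Qed.

(* At the first disagreement, u postpones the next letter be of x; the letter *)
(* just before the postponed be must be larger than be.                       *)
Lemma exists_descent_to_undo n (x u : seq 'I_n) :
    perm_eq x u -> inversion_le x u -> x <> u ->
  exists P (a b : 'I_n) Q, [/\ u = P ++ b :: a :: Q, a < b &
    ~ inverted x a (occ a P) b (occ b P)].
Proof.
move=> pxu le_xu /(neq_split (perm_size pxu))[P [al [be [X [U [Ex Eu ne]]]]]].
have : be \in al :: U.
  by move: pxu; rewrite Ex Eu perm_cat2l => /perm_mem <-; exact: mem_head.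
rewrite in_cons eq_sym (negPf ne) /= => beU.
have [R [Q [EU nR]]] : exists R Q, U = R ++ be :: Q /\ be \notin R.
  exists (take (index be U) U), (drop (index be U).+1 U); split.
    rewrite -[in LHS](cat_take_drop (index be U) U).
    by rewrite (drop_nth be) ?index_mem // nth_index.
  by rewrite in_take // ltnn.
have nRR : be \notin al :: R by rewrite in_cons negb_or eq_sym ne.
have Eu' : u = P ++ (al :: R) ++ be :: Q by rewrite Eu EU.
have [R' [ga ER]] : exists R' ga, al :: R = rcons R' ga.
  by exists (belast al R), (last al R); exact: lastI.
rewrite ER in Eu' nRR.
have nga : (ga == be) = false.
  by apply/eqP=> E; move: nRR; rewrite E mem_rcons mem_head.
have cR' : occ be R' = 0.
  by apply/count_memPn; apply: contra nRR; rewrite mem_rcons in_cons => ->; rewrite orbT.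
have Eu2 : u = (P ++ R') ++ ga :: be :: Q by rewrite Eu' -cats1 -!catA.
case: (ltngtP ga be) => [lt|lt|/val_inj E]; last by rewrite E eqxx in nga.
(* Here [x] has this copy of [be] before this copy of [ga], while [u] has them adjacent in the
   opposite order, against containment. *)
- have : inverted x ga (occ ga (P ++ R')) be (occ be (P ++ R')).
    exists (size P).+1; rewrite Ex take_cat_size1 !occE cR' eqxx.
    by rewrite [be == ga]eq_sym nga; lia.
  case/le_xu => // j []; rewrite Eu2 => h1 h2; exfalso; move: h1 h2.
  have nbg : (be == ga) = false by rewrite eq_sym.
  case: (take_cat2 (P ++ R') Q j) => [->|->|[i ->]].
  + by have := occ_take_le be (P ++ R') j; lia.
  + by rewrite !occE nga; lia.
  + by rewrite !occE eqxx nbg nga; lia.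
(* A prefix of [x] with so few copies of [be] stays inside [P], hence has too few copies of [ga]. *)
- exists (P ++ R'), be, ga, Q; split=> // -[j [h1 h2]].
  have lejP : j <= size P.
    rewrite leqNgt; apply/negP => ltP.
    have := occ_take_leq be x ltP.
    rewrite {1}Ex take_cat_size1 !occE eqxx.
    by move: h1; rewrite occ_cat cR'; lia.
  have := occ_take_leq ga x lejP.
  by rewrite {2}Ex take_size_cat //; move: h2; rewrite occ_cat; lia.
Qed.

(** * Swap steps and the order on barcode words *)

Lemma swap_tuple (T : eqType) N (s : N.-tuple T) (k l : 'I_N) P (x y : T) Q :
    val l = k.+1 -> size P = k -> s = P ++ x :: y :: Q :> seq T ->
  [tuple tnth s (tperm k l i) | i < N] = P ++ y :: x :: Q :> seq T.
Proof.
move=> El Ek Es; have Esz : N = size (P ++ x :: y :: Q) by rewrite -Es size_tuple.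
apply: (@eq_from_nth _ x) => [|i]; rewrite size_tuple.
  by rewrite Esz !size_cat.
move=> lt_iN; rewrite -[i]/(val (Ordinal lt_iN)) -tnth_nth tnth_mktuple.
rewrite (tnth_nth x) Es !nth_cat Ek.
case: tpermP => [->|->|/eqP nk /eqP nl] /=.
- by rewrite El ltnNge leqnSn ltnn subSnn subnn.
- by rewrite ltnn subnn El ltnNge leqnSn /= subSnn.
- case: ltnP => // le_ki; move: nk nl; rewrite -!val_eqE /= El => nk nl.
  by case Ei: (i - k) => [|[|j]] //=; lia.
Qed.

Lemma swap_stepP n (m : 'I_n -> nat) (s t : barcode_word m) :
  swap_step s t <-> exists P (a b : 'I_n) Q,
    [/\ s = P ++ a :: b :: Q :> seq 'I_n, t = P ++ b :: a :: Q :> seq 'I_n & a < b].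
Proof.
split=> [/existsP[k /existsP[l /and3P[/eqP El lt_kl /eqP Et]]]|].
  have Es : s = take k s ++ tnth s k :: tnth s l :: drop k.+2 s :> seq 'I_n.
    rewrite -[in LHS](cat_take_drop k s); congr cat.
    rewrite (drop_nth (tnth s k)) ?size_tuple //; congr cons; first by rewrite -tnth_nth.
    have lt_k1 : k.+1 < \sum_i m i by rewrite -El ltn_ord.
    by rewrite (drop_nth (tnth s k)) ?size_tuple // -El -tnth_nth.
  exists (take k s), (tnth s k), (tnth s l), (drop k.+2 s); split=> //.
  by rewrite Et; apply: swap_tuple Es => //; rewrite size_takel // size_tuple ltnW.
case=> P [a [b [Q [Es Et lt_ab]]]].
have Esz : \sum_i m i = size P + (size Q).+2.
  by rewrite -(size_tuple s) Es size_cat.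
have lt_k : size P < \sum_i m i by lia.
have lt_l : (size P).+1 < \sum_i m i by lia.
apply/existsP; exists (Ordinal lt_k); apply/existsP; exists (Ordinal lt_l).
rewrite eqxx !(tnth_nth a) Es !nth_cat /= ltnn subnn [_.+1 < _]ltnNge leqnSn subSnn /= lt_ab.
by apply/eqP/val_inj; rewrite /= Et; apply/esym/swap_tuple.
Qed.

Lemma occ_barcode n (m : 'I_n -> nat) (w : barcode_word m) i : occ i w = m i.
Proof. by case: w => w /= /andP[/forallP/(_ i)/eqP]. Qed.

Lemma is_barcode_word_swap n (m : 'I_n -> nat) P (a b : 'I_n) Q : a < b ->
  is_barcode_word m (P ++ b :: a :: Q) -> is_barcode_word m (P ++ a :: b :: Q).
Proof.
move=> lt_ab /andP[/forallP cnt /forallP fst]; apply/andP; split.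
  apply/forallP=> i; rewrite -(eqP (cnt i)); apply/eqP.
  by rewrite !count_cat /= (addnCA (a == i)%N).
apply/forallP=> i; apply/forallP=> j; apply/implyP=> Ej.
move/forallP: (fst i) => /(_ j); rewrite Ej /= !index_cat /=.
have nab : a == b = false by apply/negP=> /eqP E; rewrite E ltnn in lt_ab.
have := index_mem i P; have := index_mem j P.
case: (j \in P); case: (i \in P) => lt_j lt_i //.
- by move/(leq_ltn_trans (leq_addr _ _))/(ltn_trans lt_j); rewrite ltnn.
- by move=> _; apply: ltn_addr.
rewrite !ltn_add2l; case: (eqVneq b j) => [//|_].
case: (eqVneq a j) => [Ea|_]; case: (eqVneq b i) => [Ei|_].
(* Only for [a = j], [b = i] could the swap spoil the order of first occurrences, but then b < a. *)
- by move: lt_ab; rewrite Ea Ei (eqP Ej) => /ltnW; rewrite ltnn.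
- by case: (a == i).
- by rewrite -Ei nab.
- by case: (a == i).
Qed.

Lemma exists_swap_step n (m : 'I_n -> nat) (t : barcode_word m) P (a b : 'I_n) Q :
    t = P ++ b :: a :: Q :> seq 'I_n -> a < b ->
  exists2 s : barcode_word m, s = P ++ a :: b :: Q :> seq 'I_n & swap_step s t.
Proof.
move=> Et lt_ab; have sz : size (P ++ a :: b :: Q) == \sum_i m i.
  by rewrite -(size_tuple t) Et !size_cat.
have bw : is_barcode_word m (Tuple sz).
  by apply: is_barcode_word_swap => //; rewrite -Et; case: (t).
exists (BarcodeWord bw) => //; apply/swap_stepP.
by exists P, a, b, Q.
Qed.

Lemma swap_step_ltW n (m : 'I_n -> nat) (s t : barcode_word m) :
  swap_step s t -> (s < t)%O.
Proof.
move=> st; rewrite lt_neqAle; apply/andP; split; last exact: connect1.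
by apply/eqP=> E; have := swap_step_weight st; rewrite E ltnn.
Qed.

Lemma lt_swap_step n (m : 'I_n -> nat) (s t : barcode_word m) :
  (s < t)%O -> exists2 c, (s <= c)%O & swap_step c t.
Proof.
rewrite lt_neqAle => /andP[ne /connectP[p]].
case/lastP: p => [_ /= E|p c]; first by rewrite E eqxx in ne.
rewrite rcons_path last_rcons => /andP[sp step] E; subst c.
by exists (last s p) => //; apply/connectP; exists p.
Qed.

(** The weight drops along each step and is bounded by [B], so [B - word_weight t] measures the
    induction upwards. *)
Lemma swap_step_ind n (m : 'I_n -> nat) (K : barcode_word m -> Prop) :
  (forall t, (forall s, swap_step s t -> K s) -> K t) -> forall t, K t.
Proof.
move=> IH t; pose B := \max_(s : barcode_word m) word_weight s.
have [k] := ubnP (B - word_weight t); elim: k t => // k IHk t lt_tk.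
apply: IH => s st; apply: IHk.
have := swap_step_weight st; have : word_weight s <= B by exact: leq_bigmax.
by lia.
Qed.

Lemma perm_barcode n (m : 'I_n -> nat) (s t : barcode_word m) : perm_eq s t.
Proof. by apply: perm_occ => i; rewrite !occ_barcode. Qed.

(** Conversely to the monotonicity of swaps, if [s] differs from [t], some descent of [t] has an
    inversion absent from [s]; undoing it preserves containment, and induction applies. *)
Lemma barcode_leP n (m : 'I_n -> nat) (s t : barcode_word m) :
  (s <= t)%O <-> inversion_le s t.
Proof.
split=> [/connectP[p]|].
  elim: p s => [|u p IHp] s /=; first by move=> _ -> a b p q.
  case/andP=> /swap_stepP[P [a [b [Q [Es Eu lt_ab]]]]] up Et a' b' i j lt' inv.
  by apply: (IHp u) => //; rewrite Eu; apply: inversion_le_swap => //; rewrite -Es.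
elim/swap_step_ind: t => t IHt le_st.
have [->|/eqP ne] := eqVneq s t; first exact: lexx.
have [|P [a [b [Q [Et lt_ab ninv]]]]] :=
  exists_descent_to_undo (perm_barcode s t) le_st.
  by move=> E; apply: ne; do 2!apply: val_inj.
have [c Ec ct] := exists_swap_step Et lt_ab.
apply: le_trans (ltW (swap_step_ltW ct)); apply: IHt => // a' b' p q lt' inv.
rewrite Ec; have := le_st a' b' p q lt' inv; rewrite Et.
by case/(inverted_swap lt_ab lt') => // -[Ea Ep Eb Eq]; subst; case: ninv.
Qed.

(** * Descents, sorted cuts and join-irreducibility *)

Lemma exists_first_descent n (w : seq 'I_n) : ~~ sorted <=%O w ->
  exists P (a b : 'I_n) Q, [/\ w = P ++ b :: a :: Q, a < b & sorted <=%O (rcons P b)].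
Proof.
elim/last_ind: w => // w z IHw.
have [srt_w|/IHw[P [a [b [Q [-> ? ?]]]]] _] := boolP (sorted <=%O w); last first.
  by exists P, a, b, (rcons Q z); rewrite -cats1 -catA /= cats1.
case/lastP: w srt_w {IHw} => // P b srt_P.
rewrite le_sorted_pairwise pairwise_rcons -le_sorted_pairwise srt_P andbT => nall.
exists P, z, b, [::]; split=> //; first by rewrite -!cats1 -catA.
rewrite ltnNge; apply: contra nall => le_bz.
rewrite all_rcons leEord le_bz /=.
move: srt_P; rewrite le_sorted_pairwise pairwise_rcons => /andP[/allP le_Pb _].
by apply/allP => x /le_Pb; rewrite !leEord => /leq_trans; apply.
Qed.

Lemma sorted_cat2 n (P Q : seq 'I_n) (a b : 'I_n) :
  sorted <=%O (P ++ b :: a :: Q) -> b <= a.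
Proof. by move/cat_sorted2 => [_ /= /andP[]]. Qed.

Definition sorted_cut n (w : seq 'I_n) s :=
  sorted <=%O (take s w) && sorted <=%O (drop s w).

(** A descent fits in neither sorted part, so the cut splits it. Hence a word with a descent has at
    most one cut, and a word with a cut at most one descent. *)
Lemma sorted_cut_descent n (P Q : seq 'I_n) (a b : 'I_n) s : a < b ->
  sorted_cut (P ++ b :: a :: Q) s -> s = (size P).+1.
Proof.
move=> lt_ab /andP[srt_t srt_d].
have [le_s|lt_s|->//] := ltngtP s (size P).+1; exfalso.
  move: srt_d; rewrite drop_cat; have [lt_sP|le_Ps] := ltnP s (size P).
    by move/sorted_cat2; rewrite leqNgt lt_ab.
  have -> : s = size P by apply/eqP; rewrite eqn_leq le_Ps -ltnS le_s.
  by rewrite subnn drop0 => /(@sorted_cat2 _ [::]); rewrite leqNgt lt_ab.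
move: srt_t; rewrite take_cat ltnNge ltnW ?(ltnW lt_s) //=.
have -> : s - size P = (s - (size P).+2).+2 by lia.
by move/sorted_cat2; rewrite leqNgt lt_ab.
Qed.

(** Undoing descents leads from any word down to the sorted one, which is therefore the minimum. *)
Lemma sorted_not_join_irreducible n (m : 'I_n -> nat) (w : barcode_word m) :
  sorted <=%O w -> ~~ join_irreducible w.
Proof.
move=> srt_w; rewrite negb_and negbK; apply/orP; left.
apply/forallP; elim/swap_step_ind => t IHt.
have [srt_t|/exists_first_descent[P [a [b [Q [Et lt_ab _]]]]]] := boolP (sorted <=%O t).
  have -> : w = t by do 2!apply: val_inj; apply: le_sorted_eq (perm_barcode w t).
  exact: lexx.
have [c _ ct] := exists_swap_step Et lt_ab.
exact: le_trans (IHt c ct) (ltW (swap_step_ltW ct)).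
Qed.

(** An inversion of [w] missing from both [c] and [d] would be the one removed by each undoing; but
    [P2] already contains the copy of [b1] that follows [P1]. So every upper bound of [c] and [d]
    has all inversions of [w]. *)
Lemma join_swap_steps n (m : 'I_n -> nat) (w c d : barcode_word m)
    P1 (a1 b1 : 'I_n) Q1 P2 (a2 b2 : 'I_n) Q2 :
    w = P1 ++ b1 :: a1 :: Q1 :> seq 'I_n -> c = P1 ++ a1 :: b1 :: Q1 :> seq 'I_n ->
    w = P2 ++ b2 :: a2 :: Q2 :> seq 'I_n -> d = P2 ++ a2 :: b2 :: Q2 :> seq 'I_n ->
    a1 < b1 -> a2 < b2 -> size P1 < size P2 ->
  is_join c d w.
Proof.
move=> Ew1 Ec Ew2 Ed lt1 lt2 lt_P.
have cw : swap_step c w by apply/swap_stepP; exists P1, a1, b1, Q1.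
have dw : swap_step d w by apply/swap_stepP; exists P2, a2, b2, Q2.
rewrite /is_join (ltW (swap_step_ltW cw)) (ltW (swap_step_ltW dw)) /=.
apply/forallP=> u; apply/implyP=> /andP[/barcode_leP cu /barcode_leP du].
apply/barcode_leP => a b p q lt_ab inv.
have := inv; rewrite {1}Ew1 => /(inverted_swap lt1 lt_ab)[|[_ _ Eb1 Eq1]].
  by rewrite -Ec; apply: cu.
have := inv; rewrite {1}Ew2 => /(inverted_swap lt2 lt_ab)[|[_ _ Eb2 Eq2]].
  by rewrite -Ed; apply: du.
have EP1 : rcons P1 b1 = take (size P1).+1 w by rewrite Ew1 take_cat_size1.
have EP2 : take (size P1).+1 P2 = take (size P1).+1 w.
  by rewrite Ew2 takel_cat.
have := occ_take_le b P2 (size P1).+1.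
by move: Eq1 Eq2; rewrite EP2 -EP1 occ_rcons -Eb1 -Eb2 eqxx; lia.
Qed.

Lemma join_irreducible_unsorted n (m : 'I_n -> nat) (w : barcode_word m) :
  ~~ sorted <=%O w ->
  join_irreducible w = [exists s : 'I_(\sum_i m i).+1, sorted_cut w s].
Proof.
move=> unsrt; have [P [a [b [Q [Ew lt_ab srt_P]]]]] := exists_first_descent unsrt.
have [c Ec cw] := exists_swap_step Ew lt_ab.
apply/idP/idP => [/andP[_]|/existsP[s cut]].
  apply: contraR => ncut.
  have lt_P : (size P).+1 < (\sum_i m i).+1.
    by rewrite -(size_tuple w) Ew size_cat /=; lia.
  have [srt|] := boolP (sorted <=%O (a :: Q)).
    case/negP: ncut; apply/existsP; exists (Ordinal lt_P).
    rewrite /sorted_cut /= Ew take_cat_size1 srt_P.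
    by rewrite -cat_rcons drop_size_cat ?size_rcons.
  case/exists_first_descent=> P' [a' [b' [Q' [EQ lt_ab' _]]]].
  have Ew' : w = (rcons P b ++ P') ++ b' :: a' :: Q' :> seq 'I_n.
    by rewrite Ew EQ cat_rcons -catA.
  have [d Ed dw] := exists_swap_step Ew' lt_ab'.
  apply/existsP; exists c; apply/existsP; exists d.
  rewrite !swap_step_ltW //=; apply: join_swap_steps Ew Ec Ew' Ed lt_ab lt_ab' _.
  by rewrite size_cat size_rcons; lia.
(* The cut fixes the position of every descent, so [c] is the only word one step below [w]. Two
   words strictly below [w] are then both below [c], and [w] is not their join. *)
have uniq_c d : swap_step d w -> d = c.
  case/swap_stepP=> P' [a' [b' [Q' [Ed Ew' lt_ab']]]].
  have szP : size P = size P'.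
    apply: succn_inj; rewrite -(sorted_cut_descent (s := s) (Q := Q) lt_ab) -?Ew //.
    by apply: (sorted_cut_descent (Q := Q') lt_ab'); rewrite -Ew'.
  do 2!apply: val_inj; rewrite /= Ec Ed.
  by move/eqP: Ew'; rewrite Ew eqseq_cat // !eqseq_cons => /and4P[/eqP-> /eqP-> /eqP-> /eqP->].
apply/andP; split.
  apply/negP=> /forallP/(_ c).
  by rewrite (lt_geF (swap_step_ltW cw)).
apply/negP => /existsP[x /existsP[y /and3P[xw yw /and3P[_ _ /forallP/(_ c)]]]].
have [d xd /uniq_c Ed] := lt_swap_step xw; have [e ye /uniq_c Ee] := lt_swap_step yw.
by subst d e; rewrite xd ye /= (lt_geF (swap_step_ltW cw)).
Qed.

(** * Sorted cuts and vectors of letter counts *)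

Lemma size_occ n (w : seq 'I_n) : size w = \sum_i occ i w.
Proof.
elim: w => [|x w IHw]; first by rewrite big1.
under eq_bigr => i _ do rewrite occ_cons.
rewrite big_split /= -IHw (bigD1 x) //= eqxx big1 // => i.
by rewrite eq_sym => /negPf ->.
Qed.

Lemma occ_leq_sum n (m : 'I_n -> nat) i : m i <= \sum_j m j.
Proof. by rewrite (bigD1 i) //= leq_addr. Qed.

Definition sorted_word n (c : 'I_n -> nat) : seq 'I_n :=
  sort <=%O (flatten [seq nseq (c i) i | i <- enum 'I_n]).

Lemma sorted_word_sorted n (c : 'I_n -> nat) : sorted <=%O (sorted_word c).
Proof. exact/sort_sorted/le_total. Qed.

Lemma occ_sorted_word n (c : 'I_n -> nat) i : occ i (sorted_word c) = c i.
Proof.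
rewrite /occ /sorted_word count_sort count_flatten sumnE 2!big_map big_enum /=.
rewrite (bigD1 i) //= count_nseq /= eqxx mul1n big1 ?addn0 // => j.
by rewrite count_nseq /= => /negPf ->.
Qed.

Lemma sorted_index_lt n (w : seq 'I_n) (i j : 'I_n) :
  sorted <=%O w -> i \in w -> i < j -> index i w < index j w.
Proof.
move=> srt wi lt_ij; have [wj|nwj] := boolP (j \in w); last first.
  by rewrite [index j w]memNindex // index_mem.
rewrite ltnNge leq_eqVlt; apply/negP=> /orP[/eqP E|lt_idx].
  by move: lt_ij; rewrite -(nth_index i wi) -[X in _ < val X](nth_index i wj) E ltnn.
have := sorted_ltn_index le_trans srt _ _ wj wi lt_idx.
by rewrite leEord leqNgt lt_ij.
Qed.

Lemma barcode_index_lt n (m : 'I_n -> nat) (w : barcode_word m) (i j : 'I_n) :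
  i < j -> index i w < index j w.
Proof.
have fst (k l : 'I_n) : val l = k.+1 -> index k w < index l w.
  move=> E; case: w => w /= /andP[_ /forallP/(_ k)/forallP/(_ l)].
  by rewrite E eqxx.
move=> lt_ij; have [d] : exists d, val j = i + d.+1 by exists (j - i).-1 => /=; lia.
elim: d j {lt_ij} => [|d IHd] j Ej; first by apply: fst; rewrite Ej addn1.
have lt_k : i + d.+1 < n by have := ltn_ord j; rewrite /= in Ej; lia.
apply: ltn_trans (IHd (Ordinal lt_k) erefl) (fst _ _ _).
by rewrite Ej /= addnS.
Qed.

Lemma sorted_barcode_inj n (m : 'I_n -> nat) (v w : barcode_word m) :
  sorted <=%O v -> sorted <=%O w -> v = w.
Proof.
move=> srt_v srt_w; do 2!apply: val_inj.
exact: le_sorted_eq srt_v srt_w (perm_barcode v w).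
Qed.

Definition sorted_cuts n (m : 'I_n -> nat) :
    {set barcode_word m * 'I_(\sum_i m i).+1} :=
  [set ws : barcode_word m * 'I__ | sorted_cut ws.1 ws.2].

(** The common codomain keeps the function type non-dependent; it holds every [m i] by
    [occ_leq_sum]. *)
Definition initial_vector n (m : 'I_n -> nat) (c : {ffun 'I_n -> 'I_(\sum_i m i).+1}) :=
  [forall i, c i <= m i] &&
  [forall i : 'I_n, forall j : 'I_n, (i < j) && (0 < c j) ==> (0 < c i)].

Definition cut_vector n (m : 'I_n -> nat)
    (ws : barcode_word m * 'I_(\sum_i m i).+1) : {ffun 'I_n -> 'I_(\sum_i m i).+1} :=
  [ffun i => inord (occ i (take ws.2 ws.1))].

Lemma cut_vectorE n (m : 'I_n -> nat) (w : barcode_word m) s i :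
  cut_vector (w, s) i = occ i (take s w) :> nat.
Proof.
rewrite ffunE inordK // ltnS; apply: leq_trans (occ_leq_sum m i).
by rewrite -(occ_barcode w); apply: occ_take_le.
Qed.

(** A sorted word is determined by its letter counts; those of the right part are the complements to
    [m]. *)
Lemma cut_vector_inj n (m : 'I_n -> nat) :
  {in sorted_cuts m &, injective (@cut_vector n m)}.
Proof.
move=> [v s] [w t]; rewrite !inE => /andP[/= srt_tv srt_dv].
move=> /andP[/= srt_tw srt_dw] /ffunP Evw.
have Et i : occ i (take s v) = occ i (take t w).
  by rewrite -!cut_vectorE Evw.
have Ed i : occ i (drop s v) = occ i (drop t w).
  apply: (@addnI (occ i (take s v))).
  by rewrite {2}Et -!occ_cat !cat_take_drop !occ_barcode.
have Etake := le_sorted_eq srt_tv srt_tw (perm_occ Et).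
have Edrop := le_sorted_eq srt_dv srt_dw (perm_occ Ed).
have Est : s = t.
  have := congr1 size Etake.
  by rewrite !size_takel ?size_tuple -1?ltnS // => /val_inj.
congr pair => //; do 2!apply: val_inj.
by rewrite /= -(cat_take_drop s v) Etake Edrop cat_take_drop.
Qed.

Lemma sorted_word_barcode n (m : 'I_n -> nat) (m_gt0 : forall i, 0 < m i)
    (c : 'I_n -> nat) :
    (forall i, c i <= m i) ->
    (forall i j : 'I_n, i < j -> 0 < c j -> 0 < c i) ->
  exists w : barcode_word m,
    w = sorted_word c ++ sorted_word (fun i => m i - c i) :> seq 'I_n.
Proof.
move=> le_cm supp_c; set w := _ ++ _.
have occ_w i : occ i w = m i by rewrite occ_cat !occ_sorted_word subnKC.
have sz : size w == \sum_i m i by rewrite size_occ; apply/eqP/eq_bigr.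
suff bw : is_barcode_word m (Tuple sz) by exists (BarcodeWord bw).
have mem_sorted_word (d : 'I_n -> nat) i : (i \in sorted_word d) = (0 < d i).
  by rewrite -has_pred1 has_count -/(occ i _) occ_sorted_word.
apply/andP; split; first by apply/forallP=> i; apply/eqP/occ_w.
apply/forallP=> i; apply/forallP=> j; apply/implyP=> /eqP Ej.
have lt_ij : i < j by rewrite [X in _ < X]Ej.
rewrite /= !index_cat !mem_sorted_word.
(* If [i] is absent from the left part, so is [j], and the sorted right part decides. *)
have [c_i|c_i] := posnP (c i).
  have [c_j|/(supp_c _ _ lt_ij)] := posnP (c j); last by rewrite c_i.
  rewrite ltn_add2l sorted_index_lt ?sorted_word_sorted // mem_sorted_word c_i.
  by rewrite subn0.
case: ifP => _; last by rewrite ltn_addr // index_mem mem_sorted_word.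
by rewrite sorted_index_lt ?sorted_word_sorted ?mem_sorted_word.
Qed.

Lemma cut_vector_image n (m : 'I_n -> nat) (m_gt0 : forall i, 0 < m i) :
  @cut_vector n m @: sorted_cuts m = [set c | initial_vector c].
Proof.
apply/setP=> c; rewrite inE; apply/imsetP/andP => [[[w s] /= _ ->]|[]].
  split; apply/forallP=> i.
    by rewrite cut_vectorE -(occ_barcode w) occ_take_le.
  apply/forallP=> j; rewrite !cut_vectorE; apply/implyP=> /andP[lt_ij].
  rewrite /occ -!has_count !has_pred1 => wj.
  have := barcode_index_lt w lt_ij.
  have := ltn_ord s; rewrite ltnS -{2}(size_tuple w) => le_s.
  have wj' := mem_take wj; have wi : i \in (w : seq _).
    by rewrite -has_pred1 has_count -/(occ i _) occ_barcode.
  by move: wj; rewrite !in_take_leq // => lt_j /ltn_trans; apply.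
move=> /forallP le_cm /forallP supp_c.
have [i j lt_ij c_j|w Ew] := sorted_word_barcode m_gt0 (c := fun i => c i) le_cm.
  by have /forallP/(_ j) := supp_c i; rewrite lt_ij c_j.
have le_s : size (sorted_word (fun i => c i : nat)) < (\sum_i m i).+1.
  rewrite ltnS; apply: (@leq_trans (size w)); last by rewrite size_tuple.
  by rewrite Ew size_cat leq_addr.
exists (w, Ordinal le_s).
  rewrite inE /= /sorted_cut Ew take_size_cat // drop_size_cat //.
  by rewrite !sorted_word_sorted.
apply/ffunP=> i; apply: val_inj; rewrite /= cut_vectorE /= Ew.
by rewrite take_size_cat // occ_sorted_word.
Qed.

(** * Double counting *)

Lemma card_ord_pos_leq N k : k <= N -> #|[pred x : 'I_N.+1 | 0 < x <= k]| = k.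
Proof.
move=> le_kN; rewrite -sum1_card big_mkcond big_ord_recl /= add0n -big_mkcond /=.
by rewrite -(big_ord_widen N (fun=> 1) le_kN) sum1_card card_ord.
Qed.

Lemma card_initial_vectors n (m : 'I_n -> nat) :
  #|[set c | initial_vector (m := m) c]| =
  \sum_(r < n.+1) \prod_(j < n | j < r) m j.
Proof.
(* One more than the largest index in the support. At fixed length [r], the entries below [r] range
   independently over 1, ..., [m i] and the others vanish. *)
pose len (c : {ffun 'I_n -> 'I_(\sum_i m i).+1}) := \max_(i < n | 0 < c i) i.+1.
have len_lt c : len c < n.+1 by rewrite ltnS; apply/bigmax_leqP=> i _; apply: ltn_ord.
rewrite -sum1_card (partition_big (fun c => Ordinal (len_lt c)) xpredT) //=.
apply: eq_bigr => r _; rewrite sum1_card.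
pose F (i : 'I_n) : pred 'I_(\sum_i m i).+1 :=
  if i < r then [pred x : 'I__ | 0 < x <= m i] else [pred x : 'I__ | x == 0 :> nat].
have -> : \prod_(j < n | j < r) m j = #|family F|.
  rewrite card_family foldrE big_map big_enum big_mkcond /=.
  apply: eq_bigr => i _; rewrite /F.
  case: ifP => _; first by rewrite card_ord_pos_leq ?occ_leq_sum.
  by rewrite (eq_card1 (x := ord0)).
apply: eq_card => c; rewrite unfold_in inE; apply/andP/familyP => [[/andP[]]|cF].
  move=> /forallP le_cm /forallP supp_c /eqP Er i; rewrite /F -Er /=.
  have [lt_i|le_i] := ltnP i (len c); last first.
    rewrite !inE -leqn0 leqNgt; apply: contraL le_i => c_i.
    by rewrite -ltnNge; apply: (leq_bigmax_cond (P := fun i : 'I_n => 0 < c i)).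
  rewrite !inE le_cm andbT.
  have [c_i|//] := posnP (c i).
  suff : len c <= i by rewrite leqNgt lt_i.
  apply/bigmax_leqP => j c_j; rewrite ltnNge leq_eqVlt.
  apply/negP=> /orP[/eqP/val_inj E|lt_ij].
    by rewrite -E c_i in c_j.
  by have /forallP/(_ j) := supp_c i; rewrite lt_ij c_j c_i.
have c_pos i : (0 < c i) = (i < r).
  by have := cF i; rewrite /F; case: ifP; rewrite !inE => _; [case/andP|move/eqP->].
split.
  apply/andP; split; apply/forallP=> i.
    have := cF i; rewrite /F; case: ifP; rewrite !inE => _; first by case/andP.
    by move/eqP->.
  by apply/forallP=> j; rewrite !c_pos; apply/implyP=> /andP[]; apply: ltn_trans.
apply/eqP/val_inj; rewrite /= /len (eq_bigl (fun i : 'I_n => i < r)) //.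
apply/eqP; rewrite eqn_leq; apply/andP; split; first exact/bigmax_leqP.
case: r {F cF c_pos} => -[|r] //= lt_r.
exact: (@leq_bigmax_cond _ (fun i : 'I_n => i <= r) (fun i : 'I_n => i.+1)
          (Ordinal (lt_r : r < n)) (leqnn r)).
Qed.

(** A sorted word can be cut anywhere; an unsorted one has a cut, then unique, exactly when it is
    join-irreducible. *)
Lemma card_sorted_cut n (m : 'I_n -> nat) (w : barcode_word m) :
  #|[set s : 'I_(\sum_i m i).+1 | sorted_cut w s]| =
  (if sorted <=%O w then (\sum_i m i).+1 else 0) + join_irreducible w.
Proof.
have [srt|unsrt] := boolP (sorted <=%O w).
  rewrite (negPf (sorted_not_join_irreducible srt)) addn0 -[RHS]card_ord.
  by apply: eq_card => s; rewrite inE /sorted_cut take_sorted // drop_sorted.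
rewrite (join_irreducible_unsorted unsrt) add0n.
have [P [a [b [Q [Ew lt_ab _]]]]] := exists_first_descent unsrt.
case: existsP => [[s cut]|ncut]; last first.
  by apply: eq_card0 => s; rewrite inE; apply/negP=> cut; apply: ncut; exists s.
apply/eqP/cards1P; exists s; apply/setP=> t; rewrite !inE.
apply/idP/eqP => [cut_t|->//]; apply: val_inj => /=.
rewrite Ew in cut cut_t.
by rewrite (sorted_cut_descent lt_ab cut) (sorted_cut_descent lt_ab cut_t).
Qed.

Lemma card_sorted_barcode n (m : 'I_n -> nat) (m_gt0 : forall i, 0 < m i) :
  #|[set w : barcode_word m | sorted <=%O w]| = 1.
Proof.
have [//|//|w0 Ew0] := sorted_word_barcode m_gt0 (c := fun=> 0).
have srt0 : sorted <=%O w0.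
  rewrite Ew0; suff -> : sorted_word (fun _ : 'I_n => 0) = [::].
    exact: sorted_word_sorted.
  by apply/nilP; rewrite /nilp size_occ big1 // => i _; rewrite occ_sorted_word.
apply/eqP/cards1P; exists w0; apply/setP=> w; rewrite !inE.
by apply/idP/eqP => [srt|->//]; apply: sorted_barcode_inj.
Qed.

Lemma card_join_irreducible n (m : 'I_n -> nat) (m_gt0 : forall i, 0 < m i) :
  (\sum_i m i).+1 + #|[set x : barcode_word m | join_irreducible x]| =
  \sum_(r < n.+1) \prod_(j < n | j < r) m j.
Proof.
rewrite -card_initial_vectors -cut_vector_image // card_in_imset.
  2: exact: cut_vector_inj.
transitivity (\sum_(w : barcode_word m)
    \sum_(s : 'I_(\sum_i m i).+1 | sorted_cut w s) 1); last first.
  by rewrite pair_big_dep -sum1_card; apply: eq_bigl => ws; rewrite inE.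
rewrite (eq_bigr _ (fun w _ => etrans (sum1dep_card _) (card_sorted_cut w))).
rewrite [RHS]big_split /=; congr (_ + _).
  rewrite -big_mkcond sum_nat_const (_ : #|_| = 1) ?mul1n //.
  by apply: etrans (card_sorted_barcode m_gt0); apply: eq_card => w; rewrite inE.
rewrite -sum1_card big_mkcond; apply: eq_bigr => w _.
by rewrite inE; case: join_irreducible.
Qed.

(** * The closed form *)

Local Open Scope ring_scope.

Lemma sum_prod_lt_gt n (m : 'I_n -> int) :
  \sum_(i < n) (\prod_(j < n | (j < i)%N) m j) * (\prod_(j < n | (i < j)%N) (m j + 1))
  = \prod_(i < n) (m i + 1) - \prod_(i < n) m i.
Proof.
(* [T] interpolates between the two full products; the summand at [i] is [T i - T i.+1], so the sum
   telescopes. *)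
pose T k := (\prod_(j < n | (j < k)%N) m j) * (\prod_(j < n | (k <= j)%N) (m j + 1)).
have step (i : 'I_n) :
    (\prod_(j < n | (j < i)%N) m j) * (\prod_(j < n | (i < j)%N) (m j + 1))
    = T i - T i.+1.
  have ge_i : \prod_(j < n | (i <= j)%N) (m j + 1)
      = (m i + 1) * \prod_(j < n | (i < j)%N) (m j + 1).
    rewrite (bigD1 i) //=; congr (_ * _); apply: eq_bigl => j.
    by rewrite ltn_neqAle eq_sym andbC.
  have lt_Si : \prod_(j < n | (j < i.+1)%N) m j = m i * \prod_(j < n | (j < i)%N) m j.
    rewrite (bigD1 i) //=; congr (_ * _); apply: eq_bigl => j.
    by rewrite ltnS andbC [RHS]ltn_neqAle.
  by rewrite /T ge_i lt_Si; ring.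
rewrite (eq_bigr _ (fun i _ => step i)) -(big_mkord xpredT (fun k => T k - T k.+1)).
under eq_bigr => i _ do rewrite -opprB.
rewrite sumrN telescope_sumr // opprB /T; congr (_ - _).
  by rewrite big_pred0 ?mul1r.
rewrite [X in _ * X]big_pred0 => [|i].
  by rewrite mulr1; apply: eq_bigl => i; rewrite ltn_ord.
by rewrite leqNgt ltn_ord.
Qed.

Theorem theorem3p4 (n : nat) (m : 'I_n -> nat)
    (m_gt0 : forall i : 'I_n, (0 < m i)%N) :
  (#|[set x : barcode_word m | join_irreducible x]|%:Z : int) =
    \prod_(i < n) ((m i)%:Z + 1)
    - (\sum_(i < n) (m i)%:Z + 1)
    - \sum_(i < n | (i.+1 < n)%N)
        ((\prod_(j < n | (j < i)%N) (m j)%:Z)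
         * (\prod_(j < n | (i < j)%N) ((m j)%:Z + 1) - 1)).
Proof.
have := congr1 Posz (card_join_irreducible m_gt0).
have PoszS I (r : seq I) P F := big_morph Posz PoszD (erefl 0) (I := I) r P F.
have PoszP I (r : seq I) P F := big_morph Posz PoszM (erefl 1) (I := I) r P F.
rewrite PoszD -addn1 PoszD !PoszS => /(canRL (addKr _)) ->.
under [\sum_(r < n.+1) _]eq_bigr => r _ do rewrite PoszP.
(* The term at [r = n] is the full product of [m], which cancels against the one from
   [sum_prod_lt_gt]. *)
rewrite big_ord_recr /= [X in _ + (_ + X)](eq_bigl xpredT).
  2: by move=> i; rewrite /= ltn_ord.
pose p i := \prod_(j < n | (j < i)%N) (m j)%:Z.
pose q i := \prod_(j < n | (i < j)%N) ((m j)%:Z + 1).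
have -> : \sum_(i < n | (i.+1 < n)%N) p i * (q i - 1)
    = \sum_(i < n) p i * q i - \sum_(i < n) p i.
  rewrite -sumrB big_mkcond; apply: eq_bigr => i _; rewrite mulrBr mulr1.
  (* At the last index [q i] is an empty product, so the added term is zero. *)
  case: ltnP => // le_ni; rewrite /q big_pred0 ?mulr1 ?subrr // => j.
  by apply/negP=> lt_ij; have := ltn_ord j; lia.
by rewrite sum_prod_lt_gt -/p; ring.
Qed.
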